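(* Given integers $d\ge 1$ and $r\ge 2$, let $n=T(r,d)=(r-1)(d+1)+1$. There is $N=N(d,r)\in\mathbb{N}$ such that every sequence of length $N$ of vectors in $\mathbb{R}^d$ in strong general position contains a subsequence $p_1,\dots,p_n$ of length $n$ whose Tverberg partitions are exactly the rainbow partitions; that is, a partition $A_1,\dots,A_r$ of $[n]$ into $r$ non-empty parts is a Tverberg partition for $p_1,\dots,p_n$ if and only if it is a rainbow partition.
   Context: Write $[n]=\{1,\dots,n\}$. A subsequence keeps the order of the indices. Tverberg partition: a partition $A_1,\dots,A_r$ of $[n]$ into $r$ non-empty parts is a Tverberg partition for $p_1,\dots,p_n\in\mathbb{R}^d$ if $\bigcap_{m=1}^r \operatorname{conv}\{p_i: i\in A_m\}\neq\emptyset$. Rainbow partition: with $n=(r-1)(d+1)+1$, define blocks $B_s=\{(s-1)(r-1)+1,(s-1)(r-1)+2,\dots,s(r-1)+1\}$ for $s\in[d+1]$ (so each block has $r$ elements and consecutive blocks share exactly one element). A partition $A_1,\dots,A_r$ of $[n]$ is proper if $1\le|A_m|\le d+1$ for all $m$. A proper partition is rainbow if $|A_m\cap B_s|=1$ for all $m\in[r]$ and $s\in[d+1]$. Strong general position: a sequence of points $p_1,\dots,p_N\in\mathbb{R}^d$ is in strong general position if for every $k\ge 1$ and any $k$ pairwise disjoint subsets $C_1,\dots,C_k\subset[N]$, the affine hulls $H_m=\operatorname{aff}\{p_i: i\in C_m\}$ satisfy $d-\dim\big(\bigcap_{m=1}^k H_m\big)=\min\big(d+1,\ \sum_{m=1}^k(d-\dim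 H_m)\big)$, where $\dim\emptyset=-1$. *)

(* Defs.v *)
From mathcomp Require Import all_boot all_order all_algebra.
From mathcomp Require Import boolp classical_sets reals convex.

Set Implicit Arguments.
Unset Strict Implicit.
Unset Printing Implicit Defensive.
Import Order.TTheory GRing.Theory Num.Theory.
Local Open Scope classical_set_scope.
Local Open Scope ring_scope.

Section Hulls.
Context (R : realType) (d : nat).
Implicit Types X S : set 'rV[R]_d.

Definition conv_hull X : set 'rV[R]_d :=
  smallest (@convex_set R 'rV[R]_d) X.

Definition affine_set S : Prop :=
  forall (x y : 'rV[R]_d) (t : R), S x -> S y -> S (t *: x + (1 - t) *: y).

(* The empty set is affine, so [aff_hull set0 = set0]. *)
Definition aff_hull X : set 'rV[R]_d := smallest affine_set X.

(* [aff_dim (x + V) = \dim V]; in particular [aff_dim set0 = -1]. The value is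
   only meaningful on affine sets: it is also -1 on sets that are not affine. *)
Definition aff_dim S : int :=
  xget (-1) [set k : int | exists (x : 'rV[R]_d) (V : {vspace 'rV[R]_d}),
    S = [set x + v | v in [set` V]] /\ k = (\dim V)%:Z].

Definition strong_general_position (N : nat) (p : 'I_N -> 'rV[R]_d) : Prop :=
  forall (k : nat) (C : 'I_k -> {set 'I_N}),
    (1 <= k)%N ->
    (forall i j : 'I_k, i != j -> [disjoint C i & C j]%B) ->
    let H (m : 'I_k) := aff_hull [set p i | i in [set` C m]] in
    d%:Z - aff_dim (\bigcap_(m in [set: 'I_k]) H m)
    = Num.min (d.+1)%:Z (\sum_(m < k) (d%:Z - aff_dim (H m))).

Definition is_tverberg (n : nat) (p : 'I_n -> 'rV[R]_d)
    (P : {set {set 'I_n}}) : Prop :=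
  \bigcap_(A in [set` P]) conv_hull [set p i | i in [set` A]] !=set0.

End Hulls.

Definition tverberg_number (r d : nat) : nat := ((r - 1) * (d + 1) + 1)%N.

(* Indices and blocks are counted from 0: the block [s] here is the set
   {s(r-1)+1, ..., (s+1)(r-1)+1} of 1-based indices. *)
Definition block (r d : nat) (s : 'I_d.+1) : {set 'I_(tverberg_number r d)} :=
  [set i : 'I_(tverberg_number r d) |
    (s * (r - 1) <= i <= s.+1 * (r - 1))%N]%SET.

Definition proper_partition (r d : nat)
    (P : {set {set 'I_(tverberg_number r d)}}) : Prop :=
  forall A, A \in P -> (1 <= #|A| <= d + 1)%N.

Definition rainbow (r d : nat)
    (P : {set {set 'I_(tverberg_number r d)}}) : Prop :=
  proper_partition P /\
  forall A, A \in P -> forall s : 'I_d.+1, #|A :&: block r s| = 1%N.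

(* Main.v *)
Require Import Defs.
From mathcomp Require Import all_boot all_order all_algebra.
From mathcomp Require Import boolp classical_sets reals convex interval_inference.
From mathcomp Require Import lra ring zify.
Set Implicit Arguments.
Unset Strict Implicit.
Unset Printing Implicit Defensive.
Import Order.TTheory GRing.Theory Num.Theory.
Local Open Scope ring_scope.

(** The points p are studied through their lifts x = (p, 1) in R^(d+1). A
    partition is a Tverberg partition iff there are non-negative weights, of
    positive sum on each part, for which the weighted sums of the lifts over the
    parts all coincide. Each linear functional on R^(d+1) turns this into an equality
    of sums of reals, and the proof rests on choosing d + 1 functionals well.

    Call a sequence stretched if there are functionals f_0, ..., f_d, positive
    on all its lifts, such that each quotient f_(k+1) / f_k grows by at least a
    large factor C from one point to the next. Every long sequence in general
    position has a stretched subsequence of prescribed length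
    ([stretched_subsequence]). After a first use of Ramsey's theorem all
    (d+1)-tuples have the same orientation. The functional f_k is then the
    determinant against the first k and the last d - k points. The growth of
    f_(k+1) / f_k is a cross-ratio in the pencil of hyperplanes through the
    points that f_k and f_(k+1) have in common, as the three-term
    Grassmann-Pluecker relation [plucker] shows. A second use of Ramsey's theorem
    makes this cross-ratio large for all choices of points or for none, and
    [unbounded_cross_ratio] excludes the second case: in a long increasing
    sequence of reals some cross-ratio is large.

    In a stretched sequence every Tverberg partition is rainbow
    ([rainbow_of_solution]). Apply f_k to the common weighted sum. In each part
    some point contributes at least the fraction 1/n of the result; mark it in
    row k. Because of the growth, the points marked in row k lie weakly to the
    left of those marked in row k + 1. Each of the d + 1 rows has at least r marked
    points, and there are only n = (r-1)(d+1)+1 points, so there is no slack: the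
    points marked in row k are exactly the block k, one in each part.

    Conversely, let the partition be rainbow. Counting dimensions yields weights, not all
    zero, with equal sums over the parts ([common_combination]). Rescaling the
    points and the functionals turns the matrix f_k(x_i) into one that is 1 for i
    in the block k and at most 1/C elsewhere ([normalised_peak],
    [normalised_small]). Each block meets each part once, so all rescaled weights
    in a block are close to the same value. Consecutive blocks share a point,
    hence all rescaled weights are close to each other and have the same sign
    ([rainbow_solution_same_sign]). *)

(** * Ramsey's theorem *)

Lemma popular_value (T : Type) (Q : finType) (g : T -> Q) (m : nat) (t : seq T) :
  (#|Q| * m < size t)%N -> exists q, (m <= count (fun x => g x == q) t)%N.
Proof.
move=> ht; apply/existsP; apply: contraLR ht; rewrite negb_exists -leqNgt.
move=> /forallP small.
suff -> : size t = (\sum_q count (fun x => g x == q) t)%N.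
  rewrite -sum_nat_const; apply: leq_sum => q _.
  by have := small q; rewrite -ltnNge => /ltnW.
elim: t {small} => [|x t IH] /=; first by rewrite big1.
rewrite big_split /= -IH (bigD1 (g x)) //= eqxx big1 ?addn0 // => q.
by rewrite eq_sym => /negbTE ->.
Qed.

(** The induction on [k] follows Erdos and Rado: thin the sequence out until the
    colour of a [k.+1]-tuple depends on its first entry only, then keep the
    entries that carry the most popular colour. *)
Lemma ramsey (Q : finType) (k m : nat) :
  exists N, forall (T : eqType) (c : seq T -> Q) (s : seq T),
    (N <= size s)%N -> uniq s ->
    exists2 t, subseq t s /\ size t = m &
    exists q, forall u, subseq u t -> size u = k -> c u = q.
Proof.
elim: k m => [|k IHk] m.
  exists m => T c s hs _; exists (take m s).
    by rewrite take_subseq size_takel.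
  by exists (c [::]) => u _ /size0nil ->.
(* A subsequence on which the first entry [x] alone decides the colour. *)
have [N hN] : exists N, forall (T : eqType) (c : seq T -> Q) (s : seq T),
    (N <= size s)%N -> uniq s ->
    exists2 t, subseq t s /\ size t = (#|Q| * m).+1 &
    exists g : T -> Q,
      forall x u, subseq (x :: u) t -> size u = k -> c (x :: u) = g x.
  elim: (_.+1) => [|L [N' hN']].
    by exists 0 => T c s _ _; exists [::]; rewrite ?sub0seq //; exists (fun=> c [::]).
  have [N1 hN1] := IHk N'.
  exists N1.+1 => T c [//|x s] /=; rewrite ltnS => hs /andP[_ us].
  have [t1 [t1s t1N] [q hq]] := hN1 T (fun u => c (x :: u)) s hs us.
  have [|t2 [t2t1 t2L] [g hg]] := hN' T c t1 _ (subseq_uniq t1s us).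
    by rewrite t1N.
  exists (x :: t2).
    by rewrite /= eqxx t2L; split=> //; apply: subseq_trans t1s.
  exists (fun y => if y == x then q else g y) => y u /=.
  case: eqP => [->|_ yu su]; last exact: hg.
  by move=> ut2 su; apply: hq => //; apply: subseq_trans t2t1.
exists N => T c s hs us; have [t [ts tL] [g hg]] := hN T c s hs us.
have [|q hq] := @popular_value T Q g m t; first by rewrite tL.
exists (take m [seq x <- t | g x == q]).
  rewrite size_takel ?size_filter //; split=> //.
  by apply: subseq_trans ts; apply: subseq_trans (filter_subseq _ _); apply: take_subseq.
exists q => -[//|x u] xu [su].
have xut : subseq (x :: u) [seq x <- t | g x == q].
  exact: subseq_trans xu (take_subseq _ _).
rewrite hg ?(subseq_trans xut) ?filter_subseq //.
have: x \in [seq x <- t | g x == q] by apply: (mem_subseq xut); rewrite mem_head.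
by rewrite mem_filter => /andP[/eqP].
Qed.

(** * Brackets and the Grassmann-Pluecker relation *)

Definition bracket (F : fieldType) (D : nat) (v : seq 'rV[F]_D) : F :=
  \det (\matrix_(i < D) nth 0 v i).

Section Bracket.
Variables (F : fieldType) (D : nat).
Implicit Types (u v w a b p q : 'rV[F]_D) (s : seq 'rV[F]_D).

(** The bracket is linear in each entry; the covector collects the cofactors of
    the row of that entry. *)
Lemma bracket_functional s1 s2 : (size s1 < D)%N ->
  exists f : 'cV[F]_D, forall v, bracket (s1 ++ v :: s2) = (v *m f) 0 0.
Proof.
move=> hk; set i0 := Ordinal hk.
pose A v := \matrix_(i < D) nth 0 (s1 ++ v :: s2) i.
exists (\col_j cofactor (A 0) i0 j) => v.
rewrite /bracket (expand_det_row _ i0) mxE; apply: eq_bigr => j _.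
rewrite !mxE /= nth_cat ltnn subnn /=; congr (_ * (_ * \det _)).
apply/matrixP => i l; rewrite !mxE !nth_cat /=.
case: ltnP => // h; case e: (_ - _)%N => [|//].
have ee : (lift i0 i : nat) = i0.
  by apply/eqP; rewrite eqn_leq h -subn_eq0 e.
by have /eqP[] := neq_lift i0 i; apply: val_inj.
Qed.

Lemma bracket_alternate s i j : (i < j)%N -> (j < D)%N ->
  nth 0 s i = nth 0 s j -> bracket s = 0.
Proof.
move=> ij jD e; have iD := ltn_trans ij jD.
apply: (@determinant_alternate _ _ _ (Ordinal iD) (Ordinal jD)).
  by rewrite -(inj_eq val_inj) /= neq_ltn ij.
by move=> l; rewrite !mxE /= e.
Qed.

Lemma bracket_swap s1 s2 u v : ((size s1).+1 < D)%N ->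
  bracket (s1 ++ u :: v :: s2) = - bracket (s1 ++ v :: u :: s2).
Proof.
move=> hk; set k := size s1 in hk *.
have same w : bracket (s1 ++ w :: w :: s2) = 0.
  apply: (@bracket_alternate _ k k.+1) => //.
  by rewrite !nth_cat ltnn ltnNge leqnSn subnn subSnn.
have [f1 h1] := @bracket_functional s1 ((u + v) :: s2) (ltnW hk).
have sz w : (size (rcons s1 w) < D)%N by rewrite size_rcons.
have [f2 h2] := @bracket_functional (rcons s1 u) s2 (sz u).
have [f3 h3] := @bracket_functional (rcons s1 v) s2 (sz v).
have evD (f : 'cV[F]_D) : ((u + v) *m f) 0 0 = (u *m f) 0 0 + (v *m f) 0 0.
  by rewrite mulmxDl mxE.
have := same (u + v); rewrite h1 evD -!h1 -(cat_rcons u) -(cat_rcons v) h2 h3.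
rewrite !evD -!h2 -!h3 !cat_rcons !same add0r addr0 => /eqP.
by rewrite addr_eq0 => /eqP.
Qed.

(** If the bracket of [s1], [p], [q], [s2] is nonzero, these vectors form a basis.
    Of the coordinates of [b] in it, only those along [p] and [q] survive in a
    bracket that already contains [s1] and [s2]. *)
Lemma bracket_expand s1 s2 p q b : (size s1 + (size s2).+2 = D)%N ->
  bracket (s1 ++ p :: q :: s2) != 0 ->
  exists c e, forall u, bracket (s1 ++ u :: b :: s2) =
     c * bracket (s1 ++ u :: p :: s2) + e * bracket (s1 ++ u :: q :: s2).
Proof.
set k := size s1 => sz; set M := \matrix_(i < D) nth 0 (s1 ++ p :: q :: s2) i => nz.
have Mu : M \in unitmx by rewrite unitmxE unitfE.
have kD : (k < D)%N by lia.
have k1D : (k.+1 < D)%N by lia.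
pose o0 := Ordinal kD; pose o1 := Ordinal k1D; pose z := b *m invmx M.
exists (z 0 o0), (z 0 o1) => u.
have [f hf] := @bracket_functional (rcons s1 u) s2 ltac:(by rewrite size_rcons).
rewrite -!(cat_rcons u) !hf.
have -> : b = \sum_i z 0 i *: row i M by rewrite -mulmx_sum_row mulmxKV.
rewrite mulmx_suml summxE (bigD1 o0) //= (bigD1 o1) /=; last first.
  by rewrite -(inj_eq val_inj) /= neq_ltn leqnn orbT.
rewrite big1 ?addr0 => [|i /andP[ne0 ne1]].
  rewrite -!scalemxAl !rowK !mxE /= !nth_cat ltnn subnn.
  by rewrite ltnNge leqnSn subSnn.
have {}ne0 : (i : nat) != k by rewrite -(inj_eq val_inj) in ne0.
have {}ne1 : (i : nat) != k.+1 by rewrite -(inj_eq val_inj) in ne1.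
rewrite -scalemxAl mxE rowK -hf cat_rcons.
have iD := ltn_ord i.
suff -> : bracket (s1 ++ u :: nth 0 (s1 ++ p :: q :: s2) i :: s2) = 0 by rewrite mulr0.
have [ik|ki|e] := ltngtP i k; last by rewrite e eqxx in ne0.
  apply: (@bracket_alternate _ i k.+1) => //; first by rewrite ltnS ltnW.
  by rewrite !nth_cat ik ltnNge leqnSn subSnn.
apply: (@bracket_alternate _ k.+1 i) => //; first by lia.
rewrite !nth_cat ltnNge leqnSn subSnn /= (ltnNge i) (ltnW ki) /= -/k.
by have -> : (i - k)%N = (i - k.+2).+2 by lia.
Qed.

(** Modulo the span of [s1] and [s2] the space is a plane, on which the bracket is
    an area form; there the relation expands [b] in the basis [p], [q]. *)
Lemma plucker s1 s2 a b p q : (size s1 + (size s2).+2 = D)%N ->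
  bracket (s1 ++ p :: q :: s2) != 0 ->
  bracket (s1 ++ a :: b :: s2) * bracket (s1 ++ p :: q :: s2) =
  bracket (s1 ++ a :: q :: s2) * bracket (s1 ++ p :: b :: s2) -
  bracket (s1 ++ a :: p :: s2) * bracket (s1 ++ q :: b :: s2).
Proof.
move=> sz nz; have [c [e h]] := bracket_expand b sz nz.
have hk : ((size s1).+1 < D)%N by lia.
have same w : bracket (s1 ++ w :: w :: s2) = 0.
  apply: (@bracket_alternate _ (size s1) (size s1).+1) => //.
  by rewrite !nth_cat ltnn ltnNge leqnSn subnn subSnn.
rewrite !h !same (bracket_swap s2 q p hk); ring.
Qed.
End Bracket.

(** * Increasing lists of indices *)

Lemma subseq_iota (I : seq nat) (M : nat) :
  sorted ltn I -> all (fun i => i < M)%N I -> subseq I (iota 0 M).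
Proof.
move=> sI /allP bI; suff -> : I = [seq i <- iota 0 M | i \in I] by exact: filter_subseq.
apply: (irr_sorted_eq ltn_trans ltnn) => // [|i].
  by apply: sorted_filter; [exact: ltn_trans|exact: iota_ltn_sorted].
rewrite mem_filter mem_iota /= add0n.
by case: (boolP (i \in I)) => [/bI ->|].
Qed.

Lemma subseq_map_nth (T : eqType) (x0 : T) (t : seq T) (I : seq nat) :
  sorted ltn I -> all (fun i => i < size t)%N I ->
  subseq [seq nth x0 t i | i <- I] t.
Proof.
move=> sI bI; rewrite -[X in subseq _ X](mkseq_nth x0) map_subseq //.
exact: subseq_iota.
Qed.

(** The index lists used below consist of an initial interval, some indices in
    the middle, and a later interval. *)
Lemma sorted_frame (k e l : nat) (J : seq nat) : (k <= e)%N -> sorted ltn J ->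
  all (fun j => k <= j < e)%N J ->
  sorted ltn (iota 0 k ++ J ++ iota e l) /\
  all (fun i => i < e + l)%N (iota 0 k ++ J ++ iota e l).
Proof.
move=> ke sJ /allP bJ; split; last first.
  by apply/allP => i; rewrite !mem_cat !mem_iota => /or3P[|/bJ|]; lia.
rewrite !sorted_pairwise; try exact: ltn_trans.
rewrite !pairwise_cat -!(sorted_pairwise ltn_trans) !iota_ltn_sorted sJ /= andbT.
apply/andP; split; apply/allrelP => i j.
  by rewrite mem_cat !mem_iota => ? /orP[/bJ|]; lia.
by rewrite !mem_iota => /bJ; lia.
Qed.

(** * Cross-ratios of long increasing sequences *)

(** If all these cross-ratios were below [C], every interval would be shorter than
    [C] times the gap next to it, on either side. Then every gap after [t 2] would
    be at least [(t 2 - t 1) / C], so that the interval from [t 2] to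
    [t (C * C + 3)] would be longer than [C * (t 2 - t 1)], although it is adjacent
    to the gap from [t 1] to [t 2]. *)
Lemma unbounded_cross_ratio (R : realFieldType) (C m : nat) (t : nat -> R) :
  (C * C + 5 <= m)%N ->
  (forall i j, (i < j < m)%N -> t i < t j) ->
  ~ (forall a i j b, (a < i)%N -> (i < j)%N -> (j < b)%N -> (b < m)%N ->
       (t b - t a) * (t j - t i) < C%:R * ((t i - t a) * (t b - t j))).
Proof.
move=> hm inc H.
have C0 : 0 <= C%:R :> R by rewrite ler0n.
have left_gap a i j b : (a < i)%N -> (i < j)%N -> (j < b)%N -> (b < m)%N ->
    t j - t i < C%:R * (t i - t a).
  move=> ai ij jb bm; have := H _ _ _ _ ai ij jb bm.
  have := inc a i ltac:(lia); have := inc i j ltac:(lia); have := inc j b ltac:(lia).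
  by nra.
have right_gap a i j b : (a < i)%N -> (i < j)%N -> (j < b)%N -> (b < m)%N ->
    t j - t i < C%:R * (t b - t j).
  move=> ai ij jb bm; have := H _ _ _ _ ai ij jb bm.
  have := inc a i ltac:(lia); have := inc i j ltac:(lia); have := inc j b ltac:(lia).
  by nra.
have grow l : (l + 3 < m)%N -> l%:R * (t 2 - t 1) <= C%:R * (t (l + 2)%N - t 2).
  elim: l => [|l IH] lm; first by rewrite mul0r subrr mulr0.
  have := IH ltac:(lia); have := right_gap 0 1 (l + 2)%N (l + 3)%N.
  move=> /(_ isT ltac:(lia) ltac:(lia) ltac:(lia)).
  have : t 2 <= t (l + 2)%N.
    by case: l lm {IH} => [//|l] lm; apply/ltW/inc; lia.
  rewrite -natr1 addSnnS; nra.
have := grow (C * C + 1)%N ltac:(lia).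
have := left_gap 1 2 (C * C + 1 + 2)%N (C * C + 4)%N isT ltac:(lia) ltac:(lia) ltac:(lia).
have := inc 1 2 ltac:(lia); rewrite natrD natrM; nra.
Qed.

(** * Stretched subsequences *)

(** With [u] = s1, a, i, j, b, s2, where s1 has [k] entries, this is the
    inequality C [a i][j b] <= [a b][i j] between brackets completed by s1 and s2:
    in the pencil through s1 and s2, the pairs (a, i) and (j, b) are short compared
    with (i, j). See [spreadE]. *)
Definition spread (R : realFieldType) (D C k : nat) (u : seq 'rV[R]_D) : bool :=
  let b p q :=
    bracket (take k u ++ nth 0 u (k + p) :: nth 0 u (k + q) :: drop (k + 4) u) in
  C%:R * (b 0 1 * b 2 3) <= b 0 3 * b 1 2.

Lemma spreadE (R : realFieldType) (D C k : nat) (s1 s2 : seq 'rV[R]_D) a i j b :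
  size s1 = k ->
  spread C k (s1 ++ [:: a; i; j; b] ++ s2) =
  (C%:R * (bracket (s1 ++ a :: i :: s2) * bracket (s1 ++ j :: b :: s2)) <=
   bracket (s1 ++ a :: b :: s2) * bracket (s1 ++ i :: j :: s2)).
Proof.
move=> sk; rewrite /spread take_size_cat //.
have nthE p : nth 0 (s1 ++ [:: a; i; j; b] ++ s2) (k + p) = nth 0 ([:: a; i; j; b] ++ s2) p.
  by rewrite nth_cat sk ltnNge leq_addr addKn.
by rewrite !nthE drop_cat sk ltnNge leq_addr addKn /= drop0.
Qed.

(** [X i k] stands for the value of the [k]-th functional at the [i]-th point;
    the second condition says that the quotient of consecutive functionals grows
    at least [C]-fold between any two points. *)
Definition stretched (R : realFieldType) (D n C : nat) (X : nat -> nat -> R) : Prop :=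
  (forall i k, (i < n)%N -> (k < D)%N -> 0 < X i k) /\
  (forall i j k, (i < j)%N -> (j < n)%N -> (k.+1 < D)%N ->
     C%:R * (X i k.+1 * X j k) <= X i k * X j k.+1).

(** A sequence whose [D]-tuples all have the same orientation [sg]. Only brackets
    of increasing index lists occur, so that their signs are known. *)
Section Homogeneous.
Variables (R : realFieldType) (D M C : nat) (y : nat -> 'rV[R]_D) (sg : R).
Hypothesis sgE : sg * sg = 1.
Hypothesis oriented : forall I, sorted ltn I -> all (fun i => i < M)%N I ->
  size I = D -> 0 < sg * bracket [seq y i | i <- I].

(* The indices [J] between the first [k] indices and the last [D - k.+2] ones;
   [beta k] is the area form of the pencil through these [D - 2] vectors. *)
Let frame k (J : seq nat) := iota 0 k ++ J ++ iota (M - (D - k.+2)) (D - k.+2).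
Let beta k a b := bracket [seq y i | i <- frame k [:: a; b]].

Let frameP k J : (k.+2 <= D)%N -> (D <= M)%N -> sorted ltn J ->
  all (fun j => k <= j < M - (D - k.+2))%N J ->
  sorted ltn (frame k J) /\ all (fun i => i < M)%N (frame k J).
Proof.
move=> kD DM sJ bJ.
have [|sI bI] := @sorted_frame k (M - (D - k.+2)) (D - k.+2) J _ sJ bJ; first by lia.
split=> //; apply: sub_all bI => i; lia.
Qed.

Let size_frame k J : (k.+2 <= D)%N -> size (frame k J) = (D + size J - 2)%N.
Proof. by rewrite !size_cat !size_iota; lia. Qed.

Let beta_gt0 k a b : (k.+2 <= D)%N -> (D <= M)%N ->
  (k <= a)%N -> (a < b)%N -> (b < M - (D - k.+2))%N -> 0 < sg * beta k a b.
Proof.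
move=> kD DM ka ab be; have [||sI bI] := @frameP k [:: a; b] kD DM.
- by rewrite /= ab.
- by rewrite /= andbT; lia.
by apply: oriented; rewrite ?size_frame ?addnK.
Qed.

Let beta_plucker k a b p q : (k.+2 <= D)%N -> (D <= M)%N ->
  (k <= p)%N -> (p < q)%N -> (q < M - (D - k.+2))%N ->
  beta k a b * beta k p q = beta k a q * beta k p b - beta k a p * beta k q b.
Proof.
move=> kD DM kp pq qe; have pos := beta_gt0 kD DM kp pq qe.
rewrite /beta !map_cat /=; apply: plucker; first by rewrite !size_map !size_iota; lia.
by apply: contraTneq pos; rewrite /beta !map_cat /= => ->; rewrite mulr0 ltxx.
Qed.

Let beta_mul k a b c e : beta k a b * beta k c e = (sg * beta k a b) * (sg * beta k c e).
Proof. by rewrite mulrACA sgE mul1r. Qed.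

Let spread_beta k a i j b : (k.+2 <= D)%N ->
  spread C k [seq y i | i <- frame k [:: a; i; j; b]] =
  (C%:R * (beta k a i * beta k j b) <= beta k a b * beta k i j).
Proof.
move=> kD; rewrite map_cat [map _ (_ ++ iota _ _)]map_cat spreadE.
  by rewrite /beta !map_cat.
by rewrite size_map size_iota.
Qed.

(** Taking the extreme points as reference turns the points in between into an
    increasing sequence of reals: [t p] is the coordinate on the pencil that sends
    the first reference point to 0 and the last one to infinity. If no tuple were
    spread, all cross-ratios of this sequence would be bounded. *)
Lemma spread_somewhere k : (k.+2 <= D)%N -> (D + (C * C + 7) <= M)%N ->
  ~ (forall I, sorted ltn I -> all (fun i => i < M)%N I -> size I = D.+2 ->
      ~~ spread C k [seq y i | i <- I]).
Proof.
move=> kD hM none; have DM : (D <= M)%N by lia.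
pose e := (M - (D - k.+2))%N; pose z p := (k + 1 + p)%N.
pose t p := beta k k (z p) / beta k (z p) (e - 1)%N.
have w0 p : (p < C * C + 5)%N -> 0 < sg * beta k (z p) (e - 1)%N.
  by move=> hp; apply: beta_gt0; rewrite ?/z; lia.
have nz p : (p < C * C + 5)%N -> beta k (z p) (e - 1)%N != 0.
  by move=> /w0; apply: contraTneq => ->; rewrite mulr0 ltxx.
have diff p q : (p < q)%N -> (q < C * C + 5)%N ->
    beta k (z p) (z q) * beta k k (e - 1)%N =
    (t q - t p) * (beta k (z p) (e - 1)%N * beta k (z q) (e - 1)%N).
  move=> pq hq; rewrite mulrC [LHS]beta_plucker //; try by rewrite /z; lia.
  have := nz p (ltn_trans pq hq); have := nz q hq; rewrite /t => hq0 hp0.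
  by field; apply/andP.
have b0 : 0 < sg * beta k k (e - 1)%N by apply: beta_gt0; lia.
have inc p q : (p < q < C * C + 5)%N -> t p < t q.
  move=> /andP[pq hq]; have := diff p q pq hq.
  rewrite [in LHS]beta_mul [beta k (z p) (e - 1)%N * _]beta_mul => E.
  have : 0 < (t q - t p) * ((sg * beta k (z p) (e - 1)%N) * (sg * beta k (z q) (e - 1)%N)).
    by rewrite -E mulr_gt0 //; apply: beta_gt0; rewrite ?/z; lia.
  rewrite pmulr_lgt0 ?subr_gt0 // mulr_gt0 //; apply: w0 => //; exact: ltn_trans hq.
apply: (@unbounded_cross_ratio R C (C * C + 5) t) => // p i j q pi ij jq hq.
have [||sI bI] := @frameP k [:: z p; z i; z j; z q] kD DM.
- by rewrite /= /z; lia.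
- by rewrite /= /z; lia.
have := none _ sI bI ltac:(rewrite size_frame //=; lia).
rewrite spread_beta // -ltNge => lt.
pose b p := beta k (z p) (e - 1)%N; pose B := beta k k (e - 1)%N.
have diffE p' q' : (p' < q')%N -> (q' < C * C + 5)%N ->
  beta k (z p') (z q') * B = (t q' - t p') * (b p' * b q') by exact: diff.
have W0 : 0 < (b p * b i) * (b j * b q).
  rewrite /b beta_mul [X in _ * X]beta_mul.
  by apply: mulr_gt0; apply: mulr_gt0; apply: w0; lia.
have V0 : 0 < B * B by rewrite /B beta_mul mulr_gt0.
rewrite -(ltr_pM2r W0).
have -> : (t q - t p) * (t j - t i) * (b p * b i * (b j * b q)) =
          beta k (z p) (z q) * beta k (z i) (z j) * (B * B).
  rewrite [RHS]mulrACA !diffE; try lia; ring.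
have -> : C%:R * ((t i - t p) * (t q - t j)) * (b p * b i * (b j * b q)) =
          C%:R * (beta k (z p) (z i) * beta k (z j) (z q)) * (B * B).
  rewrite -[RHS]mulrA [in RHS]mulrACA !diffE; try lia; ring.
by rewrite ltr_pM2r.
Qed.

(** The functional number [k] is the bracket with the first [k] and the last
    [D - k.+1] vectors. Consecutive functionals differ in a single reference
    vector, [k] on the left for one and [b] on the right for the other, and
    by [beta_plucker] the inequality that [spread] asserts for [k], [D + i],
    [D + j], [b] makes their quotient grow [C]-fold. *)
Lemma stretched_functionals n : (n + (D + D) <= M)%N ->
  (forall k I, (k.+2 <= D)%N -> sorted ltn I -> all (fun i => i < M)%N I ->
     size I = D.+2 -> spread C k [seq y i | i <- I]) ->
  exists f : nat -> 'cV[R]_D,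
    stretched D n C (fun i k => (y (D + i) *m f k) 0 0).
Proof.
move=> hM all_spread.
have [f hf] : exists f : nat -> 'cV[R]_D, forall k v, (k < D)%N ->
    (v *m f k) 0 0 = sg * bracket ([seq y i | i <- iota 0 k] ++
      v :: [seq y i | i <- iota (M - (D - k.+1)) (D - k.+1)]).
  suff /choice : forall k, exists g : 'cV[R]_D, forall v, (k < D)%N ->
      (v *m g) 0 0 = sg * bracket ([seq y i | i <- iota 0 k] ++
        v :: [seq y i | i <- iota (M - (D - k.+1)) (D - k.+1)]).
    by case=> f hf; exists f.
  move=> k; case: (ltnP k D) => [kD|_]; last by exists 0.
  have [|g hg] := @bracket_functional R D [seq y i | i <- iota 0 k]
    [seq y i | i <- iota (M - (D - k.+1)) (D - k.+1)].
    by rewrite size_map size_iota.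
  by exists (sg *: g) => v _; rewrite -scalemxAr mxE hg.
exists f; split=> [i k hi kD|i j k ij jn kD].
  rewrite hf // -(map_cons y (D + i)) -map_cat.
  have [|//||sI bI] := @sorted_frame k (M - (D - k.+1)) (D - k.+1) [:: (D + i)%N].
  - by lia.
  - by rewrite /= andbT; lia.
  apply: oriented => //; last by rewrite size_cat /= !size_iota; lia.
  by apply: sub_all bI => l; lia.
have DM : (D <= M)%N by lia.
have left_end p : (y p *m f k.+1) 0 0 = sg * beta k k p.
  have split_iota : iota 0 k.+1 = iota 0 k ++ [:: k] by rewrite -addn1 iotaD.
  by rewrite hf // /beta /frame split_iota !map_cat -catA.
pose b := (M - (D - k.+1))%N.
have right_end p : (y p *m f k) 0 0 = sg * beta k p b.
  rewrite hf ?(ltnW kD) // /beta /frame map_cat.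
  have -> : (D - k.+2 = (D - k.+1).-1)%N by lia.
  have -> : (M - (D - k.+1).-1 = (M - (D - k.+1)).+1)%N by lia.
  by rewrite /b; case: (D - k.+1)%N (ltac:(lia) : (0 < D - k.+1)%N).
rewrite !left_end !right_end.
have [||sI bI] := @frameP k [:: k; (D + i)%N; (D + j)%N; b] kD DM.
- by rewrite /= /b; lia.
- by rewrite /= /b; lia.
have := all_spread k _ kD sI bI ltac:(rewrite size_frame //=; lia).
rewrite spread_beta //.
have := @beta_plucker k k b (D + i) (D + j) kD DM ltac:(lia) ltac:(lia) ltac:(lia).
have : 0 <= beta k k (D + i) * beta k (D + j) b.
  by rewrite beta_mul mulr_ge0 // ltW //; apply: beta_gt0; rewrite /b; lia.
rewrite -!beta_mul => ge0 ->; rewrite [_ * beta k (D + i) b]mulrC lerBrDr.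
by apply: le_trans; rewrite lerDl.
Qed.
End Homogeneous.

(** The length [M] leaves room for the reference vectors on both sides of the [n]
    chosen ones and for [spread_somewhere]. *)
Theorem stretched_subsequence (R : realFieldType) (D n C : nat) :
  exists N, forall x : nat -> 'rV[R]_D,
    (forall I, sorted ltn I -> all (fun i => i < N)%N I -> size I = D ->
       bracket [seq x i | i <- I] != 0) ->
    exists2 s : seq nat,
      [/\ sorted ltn s, all (fun i => i < N)%N s & size s = n] &
    exists f : nat -> 'cV[R]_D,
      stretched D n C (fun i k => (x (nth 0 s i) *m f k) 0 0).
Proof.
pose M := (n + (D + D) + (D + (C * C + 7)))%N.
have [N2 hN2] := ramsey {ffun 'I_D -> bool} D.+2 M.
have [N hN] := ramsey bool D N2.
exists N => x gp.
have [t1 [t1N t1size] [q1 hq1]] :=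
  hN _ (fun u => 0 < bracket [seq x i | i <- u]) (iota 0 N)
     ltac:(by rewrite size_iota) (iota_uniq _ _).
have [t [tt1 tsize] [q2 hq2]] :=
  hN2 _ (fun u => [ffun k : 'I_D => spread C k [seq x i | i <- u]]) t1
     ltac:(by rewrite t1size) (subseq_uniq t1N (iota_uniq _ _)).
have tN := subseq_trans tt1 t1N.
have sorted_sub u : subseq u t -> sorted ltn u /\ all (fun i => i < N)%N u.
  move=> /subseq_trans /(_ tN) ut; split.
    exact: (subseq_sorted ltn_trans ut (iota_ltn_sorted _ _)).
  by apply/allP => i /(mem_subseq ut); rewrite mem_iota.
pose y i := x (nth 0 t i).
have yE I : [seq y i | i <- I] = [seq x i | i <- [seq nth 0 t i | i <- I]].
  by rewrite -map_comp.
pose sg : R := if q1 then 1 else -1.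
have sgE : sg * sg = 1 by rewrite /sg; case: (q1); rewrite ?mulrNN mulr1.
have oriented I : sorted ltn I -> all (fun i => i < M)%N I ->
    size I = D -> 0 < sg * bracket [seq y i | i <- I].
  move=> sI bI sz; rewrite yE; set u := [seq nth 0 t i | i <- I].
  have ut : subseq u t by apply: subseq_map_nth; rewrite ?tsize.
  have su : size u = D by rewrite size_map.
  have [sou bou] := sorted_sub u ut.
  have nz := gp u sou bou su; have := hq1 u (subseq_trans ut tt1) su.
  rewrite /sg; case: (q1) => [pos|/negbT]; first by rewrite mul1r.
  by rewrite -leNgt le_eqVlt (negbTE nz) mulN1r oppr_gt0.
have spread_const k I (kD : (k < D)%N) : sorted ltn I -> all (fun i => i < M)%N I ->
    size I = D.+2 -> spread C k [seq y i | i <- I] = q2 (Ordinal kD).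
  move=> sI bI sz; rewrite yE; set u := [seq nth 0 t i | i <- I].
  have ut : subseq u t by apply: subseq_map_nth; rewrite ?tsize.
  by rewrite -(hq2 u ut) ?size_map // ffunE.
have [||f hf] := @stretched_functionals R D M C y sg sgE oriented n.
- by rewrite /M; lia.
- move=> k I kD sI bI sz; rewrite (@spread_const k I (ltnW kD)) //.
  apply/negPn/negP => neg.
  apply: (@spread_somewhere R D M C y sg sgE oriented k kD); first by rewrite /M; lia.
  by move=> J sJ bJ szJ; rewrite (@spread_const k J (ltnW kD)).
have sub : subseq (take n (drop D t)) t.
  by rewrite (subseq_trans (take_subseq _ _)) ?drop_subseq.
have [so bo] := sorted_sub _ sub.
exists (take n (drop D t)).
  by split=> //; rewrite size_takel // size_drop tsize /M; lia.
exists f; have [pos str] := hf; split=> [i k hi|i j k ij jn].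
  by rewrite nth_take // nth_drop; apply: pos.
by rewrite !nth_take ?nth_drop //; [apply: str|apply: ltn_trans jn].
Qed.

(** * Blocks *)

Lemma card_ord_interval (n a b : nat) : (#|[set i : 'I_n | (a <= i < b)%N]| <= b - a)%N.
Proof.
rewrite cardE -(size_map val) -(size_iota a (b - a)); apply: uniq_leq_size.
  by rewrite map_inj_uniq ?enum_uniq //; apply: val_inj.
move=> _ /mapP[i + ->]; rewrite mem_enum inE mem_iota /=; lia.
Qed.

Lemma partition_card_setI (T : finType) (P : {set {set T}}) (S : {set T}) :
  finset.partition P [set: T] -> #|S| = (\sum_(A in P) #|A :&: S|)%N.
Proof.
move=> hP; rewrite -sum1_card (eq_bigl (fun x => (x \in [set: T]) && (x \in S))); last first.
  by move=> x; rewrite inE.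
rewrite (set_partition_big_cond _ hP); apply: eq_bigr => A _.
by rewrite -sum1_card; apply: eq_bigl => x; rewrite inE.
Qed.

Lemma partition_mem_part (T : finType) (P : {set {set T}}) (x : T) :
  finset.partition P [set: T] -> exists2 A, A \in P & x \in A.
Proof.
move=> /cover_partition cP; have : x \in finset.cover P by rewrite cP inE.
by rewrite /finset.cover => /finset.bigcupP[A AP xA]; exists A.
Qed.

Section Blocks.
Variables (r d : nat).
Hypothesis hr : (2 <= r)%N.
Notation n := (tverberg_number r d).

Lemma block_cover (i : 'I_n) : exists s : 'I_d.+1, i \in block r s.
Proof.
have hs : (minn d (i %/ (r - 1)) < d.+1)%N by rewrite ltnS geq_minl.
exists (Ordinal hs); rewrite inE /=.
have := ltn_ord i; rewrite {2}/tverberg_number => hi.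
have := divn_eq i (r - 1); have := @ltn_pmod i (r - 1) ltac:(lia).
by case: leqP => _ hm e; nia.
Qed.

Lemma card_block (s : 'I_d.+1) : (#|block r s| <= r)%N.
Proof.
apply: leq_trans (_ : #|[set i : 'I_n | (s * (r - 1) <= i < (s.+1 * (r - 1)).+1)%N]| <= r)%N.
  by rewrite /block; apply: subset_leq_card; apply/fintype.subsetP => i; rewrite !inE.
by apply: leq_trans (card_ord_interval _ _ _) _; nia.
Qed.

(** The blocks cover everything, which bounds the parts by the number of blocks. *)
Lemma rainbow_of_block_card (P : {set {set 'I_n}}) :
  finset.partition P [set: 'I_n] ->
  (forall A, A \in P -> forall s : 'I_d.+1, #|A :&: block r s| = 1%N) -> rainbow P.
Proof.
move=> hP one; split=> // A AP; have /and3P[_ _ P0] := hP.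
have A0 : A != finset.set0 by apply: contraNneq P0 => <-.
rewrite card_gt0 A0 /= addn1.
have -> : d.+1 = (\sum_(s < d.+1) #|A :&: block r s|)%N.
  by rewrite (eq_bigr (fun=> 1%N)) ?sum1_card ?card_ord // => s _; rewrite one.
have -> : (\sum_(s < d.+1) #|A :&: block r s| = \sum_(i in A) \sum_(s | i \in block r s) 1)%N.
  rewrite (exchange_big_dep predT) //=; apply: eq_bigr => s _.
  by rewrite -sum1_card; apply: eq_bigl => i; rewrite inE.
rewrite -sum1_card; apply: leq_sum => i _; have [s hs] := block_cover i.
by rewrite (bigD1 s).
Qed.

(** Counting from the left, all elements of [E k] are at least
    [k * (r - 1)], so its largest one is at least [k.+1 * (r - 1)], and this bounds
    [E k.+1] from below. Counting from the right bounds [E k] from above. *)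
Lemma noncrossing_blocks (E : nat -> {set 'I_n}) :
  (forall k, (k <= d)%N -> (r <= #|E k|)%N) ->
  (forall k (i j : 'I_n), (k < d)%N -> i \in E k -> j \in E k.+1 -> (i <= j)%N) ->
  forall s : 'I_d.+1, E s \subset block r s.
Proof.
move=> cE noncross.
have lower k : (k <= d)%N -> forall i, i \in E k -> (k * (r - 1) <= i)%N.
  elim: k => [|k IH] kd j jE //.
  have [i iE hi] : exists2 i, i \in E k & (k.+1 * (r - 1) <= i)%N.
    apply/exists_inP; apply: contraLR (cE k (ltnW kd)).
    rewrite negb_exists_in -ltnNge => /forall_inP small.
    apply: leq_ltn_trans (_ : (k.+1 * (r - 1)) - (k * (r - 1)) < r)%N; last by nia.
    apply: leq_trans (card_ord_interval n _ _); apply: subset_leq_card.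
    by apply/fintype.subsetP => i iE; rewrite inE (IH (ltnW kd)) //= ltnNge small.
  by apply: leq_trans hi _; apply: noncross jE.
have upper l k : (k + l = d)%N -> forall i, i \in E k -> (i <= k.+1 * (r - 1))%N.
  elim: l k => [|l IH] k kl i iE.
    by have := ltn_ord i; rewrite {2}/tverberg_number; nia.
  have [j jE hj] : exists2 j, j \in E k.+1 & (j <= k.+1 * (r - 1))%N.
    apply/exists_inP; apply: contraLR (cE k.+1 ltac:(lia)).
    rewrite negb_exists_in -ltnNge => /forall_inP big.
    apply: leq_ltn_trans (_ : (k.+2 * (r - 1)).+1 - (k.+1 * (r - 1)).+1 < r)%N; last by nia.
    apply: leq_trans (card_ord_interval n _ _); apply: subset_leq_card.
    by apply/fintype.subsetP => j jE; rewrite inE ltnS (IH k.+1) ?addSnnS // andbT ltnNge big.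
  by apply: leq_trans hj; apply: noncross iE jE; lia.
move=> s; apply/fintype.subsetP => i iE; have sd := ltn_ord s; rewrite inE lower //=.
by apply: (upper (d - s)%N) => //; lia.
Qed.
End Blocks.

(** * Tverberg partitions of stretched sequences are rainbow *)

Section TverbergEquations.
Variables (R : realFieldType) (r d C : nat).
Hypothesis hr : (2 <= r)%N.
Notation n := (tverberg_number r d).
Variables (X : nat -> nat -> R) (P : {set {set 'I_n}}).
Hypothesis hX : stretched d.+1 n C X.
Hypothesis hP : finset.partition P [set: 'I_n].
Variables (al : 'I_n -> R) (Y : nat -> R).
Hypothesis eqs : forall A, A \in P -> forall k, (k <= d)%N ->
  \sum_(i in A) al i * X i k = Y k.

Let X0 (i : 'I_n) k : (k <= d)%N -> 0 < X i k.
Proof. by move=> kd; case: hX => + _; apply. Qed.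

(** [E k] is the set of points that contribute at least the fraction [1 / n] to the
    sum in row [k]. It meets every part, because a part has at most [n] elements. If [j < i],
    [i] in [E k] and [j] in [E k.+1], multiplying the two lower bounds contradicts
    the growth factor, which exceeds [n * n]. *)
Lemma rainbow_of_solution : (n * n < C)%N -> #|P| = r ->
  (forall i, 0 <= al i) -> (forall k, (k <= d)%N -> 0 < Y k) -> rainbow P.
Proof.
move=> hC cP al0 Y0.
pose E k := [set i : 'I_n | Y k <= n%:R * (al i * X i k)]%SET.
have term_le k (i : 'I_n) : (k <= d)%N -> al i * X i k <= Y k.
  move=> kd; have [A AP iA] := partition_mem_part i hP.
  rewrite -(eqs AP kd) (bigD1 i) //= lerDl sumr_ge0 // => j _.
  by rewrite mulr_ge0 // ltW // X0.
have meet k A : (k <= d)%N -> A \in P -> (0 < #|A :&: E k|)%N.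
  move=> kd AP; rewrite card_gt0; apply/negP => /eqP empty.
  have small i : i \in A -> n%:R * (al i * X i k) < Y k.
    move=> iA; rewrite ltNge; apply/negP => iE.
    have : i \in A :&: E k by rewrite !inE iA.
    by rewrite empty inE.
  have Yk := Y0 k kd; have /and3P[_ _ P0] := hP.
  have [i0 i0A] : exists i, i \in A.
    by apply/set0Pn; apply: contraNneq P0 => <-.
  have : n%:R * Y k < Y k *+ #|A|.
    rewrite -(eqs AP kd) mulr_sumr (eqs AP kd) -sumr_const.
    by apply: ltr_sum => //; apply/hasP; exists i0; rewrite ?mem_index_enum.
  rewrite -[Y k *+ _]mulr_natl ltr_pM2r // ltr_nat ltnNge.
  by rewrite -[X in (_ <= X)%N](card_ord n) max_card.
have cE k : (k <= d)%N -> (r <= #|E k|)%N.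
  move=> kd; rewrite (partition_card_setI _ hP) -[X in (X <= _)%N]cP -sum1_card.
  by apply: leq_sum => A AP; apply: meet.
have noncross k (i j : 'I_n) : (k < d)%N -> i \in E k -> j \in E k.+1 -> (i <= j)%N.
  move=> kd; rewrite !inE leqNgt => iE jE; apply/negP => ji.
  case: hX => _ /(_ j i k ji (ltn_ord i) kd) str.
  have hC' : (n%:R * n%:R < C%:R :> R) by rewrite -natrM ltr_nat.
  have Yi := Y0 k (ltnW kd); have Yj := Y0 k.+1 kd.
  have ti := term_le k j (ltnW kd); have tj := term_le k.+1 i kd.
  have Xjk := X0 j (ltnW kd); have Xik := X0 i kd.
  have p1 : Y k * Y k.+1 <= (n%:R * (al i * X i k)) * (n%:R * (al j * X j k.+1)).
    by apply: ler_pM => //; apply: ltW.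
  have p2 : (al j * X j k) * (al i * X i k.+1) <= Y k * Y k.+1.
    by apply: ler_pM => //; rewrite mulr_ge0 // ltW.
  have p3 : al i * al j * (C%:R * (X j k.+1 * X i k)) <= al i * al j * (X j k * X i k.+1).
    by apply: ler_wpM2l => //; rewrite mulr_ge0.
  have YY : 0 < Y k * Y k.+1 by rewrite mulr_gt0.
  pose Z := al i * al j * (X j k.+1 * X i k).
  have Z0 : 0 < Z.
    have : 0 < (n%:R * n%:R) * Z by apply: lt_le_trans YY _; apply: le_trans p1 _; rewrite /Z; lra.
    by rewrite pmulr_rgt0 // mulr_gt0 // ltr0n /tverberg_number addn1.
  have : C%:R * Z <= (n%:R * n%:R) * Z.
    apply: le_trans (_ : Y k * Y k.+1 <= _); last by apply: le_trans p1 _; rewrite /Z; lra.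
    by apply: le_trans p2; rewrite /Z; lra.
  by rewrite ler_pM2r // leNgt hC'.
have EB := noncrossing_blocks hr cE noncross.
apply: rainbow_of_block_card => // A AP s.
have sd : (s <= d)%N by rewrite -ltnS.
have EBs : E s = block r s.
  by apply/eqP; rewrite eqEcard EB (leq_trans (card_block hr s)) ?cE.
have count_one a b c : c = (a + b)%N -> (r.-1 <= b)%N -> (c <= r)%N -> (0 < a)%N -> a = 1%N.
  by lia.
have rest : (r.-1 <= \sum_(B in P | B != A) #|B :&: E s|)%N.
  apply: leq_trans (_ : \sum_(B in P | B != A) 1 <= _)%N.
    by rewrite -[X in (X.-1 <= _)%N]cP -sum1_card (bigD1 A).
  by apply: leq_sum => B /andP[BP _]; apply: meet.
rewrite -EBs; apply: (count_one _ _ #|E s| _ rest).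
- by rewrite (partition_card_setI (E s) hP) (bigD1 A).
- by rewrite EBs card_block.
- exact: meet.
Qed.
End TverbergEquations.

(** * Rainbow partitions of stretched sequences are Tverberg partitions *)

Section Normalisation.
Variables (R : realFieldType) (r d C : nat).
Hypothesis hr : (2 <= r)%N.
Notation n := (tverberg_number r d).
Variable X : nat -> nat -> R.
Hypothesis hX : stretched d.+1 n C X.

(* The index shared by the blocks [m] and [m.+1]. *)
Let joint m := (m.+1 * (r - 1))%N.

(** The factors that make [normalised i m] and [normalised i m.+1] equal when [i] is
    the point shared by the blocks [m] and [m.+1]. By the growth condition, for
    any other [i] the entry increases at least [C]-fold from [m] to [m.+1] if [i] lies to
    the right of the shared point, and decreases at least [C]-fold if it lies to
    the left. *)
Definition scale (k : nat) : R := \prod_(m < k) (X (joint m) m.+1 / X (joint m) m).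
Definition normalised i k := X i k / scale k.

Let joint_lt m : (m < d)%N -> (joint m < n)%N.
Proof. by rewrite /joint /tverberg_number; nia. Qed.

Let X0 i k : (i < n)%N -> (k <= d)%N -> 0 < X i k.
Proof. by move=> hi kd; case: hX => + _; apply. Qed.

Lemma scale_gt0 k : (k <= d)%N -> 0 < scale k.
Proof.
move=> kd; apply: prodr_gt0 => m _; have mk := ltn_ord m.
by rewrite divr_gt0 // X0 ?joint_lt //; lia.
Qed.

Lemma normalised_gt0 i k : (i < n)%N -> (k <= d)%N -> 0 < normalised i k.
Proof. by move=> hi kd; rewrite divr_gt0 ?scale_gt0 ?X0. Qed.

Let normalisedS i m : (m < d)%N ->
  normalised i m.+1 = (X (joint m) m * X i m.+1) / X (joint m) m.+1 / scale m.
Proof.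
move=> md; rewrite /normalised /scale big_ord_recr /= -/(scale m).
have s0 := scale_gt0 (ltnW md).
have a0 := X0 (joint_lt md) (ltnW md); have b0 := X0 (joint_lt md) md.
by field; rewrite !gt_eqF.
Qed.

Hypothesis hC : (1 <= C)%N.

Let C1 : 1 <= C%:R :> R.
Proof. by rewrite ler1n. Qed.

Let step_up i m : (m < d)%N -> (joint m < i)%N -> (i < n)%N ->
  C%:R * normalised i m <= normalised i m.+1.
Proof.
move=> md ji hi; rewrite normalisedS // /normalised mulrA.
rewrite ler_pM2r ?invr_gt0 ?scale_gt0 ?(ltnW md) // ler_pdivlMr ?X0 ?joint_lt //.
by case: hX => _ /(_ _ _ m ji hi md); rewrite mulrAC -mulrA.
Qed.

Let step_down i m : (m < d)%N -> (i < joint m)%N ->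
  C%:R * normalised i m.+1 <= normalised i m.
Proof.
move=> md ij; rewrite normalisedS // /normalised !mulrA.
rewrite ler_pM2r ?invr_gt0 ?scale_gt0 ?(ltnW md) // ler_pdivrMr ?X0 ?joint_lt //.
by case: hX => _ /(_ _ _ m ij (joint_lt md) md); rewrite [X in _ * X]mulrC mulrA.
Qed.

Let step_joint m : (m < d)%N -> normalised (joint m) m.+1 = normalised (joint m) m.
Proof.
by move=> md; rewrite normalisedS // mulfK // gt_eqF // X0 // joint_lt.
Qed.

Let up_chain i k l : (i < n)%N -> (l <= d)%N -> (l * (r - 1) <= i)%N -> (k <= l)%N ->
  normalised i k <= normalised i l.
Proof.
move=> hi; elim: l => [|l IH] ld li; first by rewrite leqn0 => /eqP ->.
rewrite leq_eqVlt => /predU1P[->//|kl].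
apply: le_trans (IH (ltnW ld) _ kl) _; first by nia.
have : (joint l <= i)%N by [].
rewrite leq_eqVlt => /predU1P[<-|ji]; first by rewrite step_joint.
by apply: le_trans (step_up ld ji hi); rewrite ler_peMl // ltW // normalised_gt0 // ltnW.
Qed.

Let down_chain i k l : (i < n)%N -> (k <= d)%N -> (i <= l.+1 * (r - 1))%N -> (l <= k)%N ->
  normalised i k <= normalised i l.
Proof.
move=> hi; elim: k => [|k IH] kd il; first by rewrite leqn0 => /eqP ->.
rewrite leq_eqVlt => /predU1P[->//|lk].
apply: le_trans (IH (ltnW kd) il lk).
have : (i <= joint k)%N by rewrite /joint; nia.
rewrite leq_eqVlt => /predU1P[->|ij]; first by rewrite step_joint.
by apply: le_trans (step_down kd ij); rewrite ler_peMl // ltW // normalised_gt0.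
Qed.

(** For fixed [i], the entries increase up to the blocks that contain [i] and
    decrease afterwards. *)
Lemma normalised_peak i k l : (i < n)%N -> (k <= d)%N -> (l <= d)%N ->
  (l * (r - 1) <= i <= l.+1 * (r - 1))%N -> normalised i k <= normalised i l.
Proof.
move=> hi kd ld /andP[li il]; have [kl|lk] := leqP k l; first exact: up_chain.
by apply: down_chain => //; apply: ltnW.
Qed.

Lemma normalised_small i k l : (i < n)%N -> (k <= d)%N -> (l <= d)%N ->
  (l * (r - 1) <= i <= l.+1 * (r - 1))%N ->
  ~~ (k * (r - 1) <= i <= k.+1 * (r - 1))%N ->
  C%:R * normalised i k <= normalised i l.
Proof.
move=> hi kd ld /andP[li il] nk; have [kl|lk|e] := ltngtP k l; last first.
- by move: nk; rewrite e li il.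
- case: k => // k in kd nk lk *.
  apply: le_trans (step_down kd _) (down_chain _ _ il _); rewrite /joint; nia.
- apply: le_trans (step_up _ _ hi) (up_chain hi ld li kl); rewrite /joint; nia.
Qed.
End Normalisation.

Section SameSign.
Variables (R : realFieldType) (r d C : nat).
Hypothesis hr : (2 <= r)%N.
Notation n := (tverberg_number r d).
Variables (X : nat -> nat -> R) (P : {set {set 'I_n}}).
Hypothesis hX : stretched d.+1 n C X.
Hypothesis hP : finset.partition P [set: 'I_n].
Variables (al : 'I_n -> R) (Y : nat -> R).
Hypothesis eqs : forall A, A \in P -> forall k, (k <= d)%N ->
  \sum_(i in A) al i * X i k = Y k.

(** In terms of the rescaled weights [ga] and the matrix [e], which is 1 on the
    blocks and at most [1 / C] elsewhere, row [s] of the system says that each [ga i]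
    with [i] in the block [s] is within [de] of a value depending on [s] only.
    Walking through the blocks, all [ga i] are within [4 * d.+1 * de] of each other,
    which is less than the largest absolute value [G]. *)
Lemma rainbow_solution_same_sign : (4 * d.+1 * n < C)%N -> rainbow P ->
  (exists i, al i != 0) -> exists i0, forall i, 0 < al i * al i0.
Proof.
move=> hC [_ rainb] [i1 nz1].
have n0 : (0 < n)%N by rewrite /tverberg_number addn1.
have C1 : (1 <= C)%N by lia.
have C0 : 0 < C%:R :> R by rewrite ltr0n.
pose g (i : 'I_n) k := normalised r X i k.
have gpos i k : (k <= d)%N -> 0 < g i k by move=> kd; apply: (normalised_gt0 hr hX).
have /choice[b hb] : forall i : 'I_n, exists s : 'I_d.+1, i \in block r s.
  by move=> i; apply: block_cover.
have bd i : (b i <= d)%N by rewrite -ltnS.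
pose ga i := al i * g i (b i).
pose e i k := g i k / g i (b i).
have inblock i : (b i * (r - 1) <= i <= (b i).+1 * (r - 1))%N by have := hb i; rewrite inE.
have e1 i (s : 'I_d.+1) : i \in block r s -> e i s = 1.
  rewrite inE => is_; rewrite /e; have -> : g i s = g i (b i); last first.
    by rewrite divff // gt_eqF // gpos.
  have sd : (s <= d)%N by rewrite -ltnS.
  by apply/eqP; rewrite eq_le !(normalised_peak hr hX C1).
have esmall i (s : 'I_d.+1) : i \notin block r s -> 0 <= e i s <= C%:R^-1.
  rewrite inE => is_; have sd : (s <= d)%N by rewrite -ltnS.
  rewrite divr_ge0 ?(ltW (gpos _ _ _)) //= ler_pdivrMr ?gpos //.
  rewrite mulrC ler_pdivlMr // mulrC.
  exact: (normalised_small hr hX C1).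
have geqs A (s : 'I_d.+1) : A \in P -> \sum_(i in A) ga i * e i s = Y s / scale r X s.
  move=> AP; have sd : (s <= d)%N by rewrite -ltnS.
  rewrite -(eqs AP sd) mulr_suml; apply: eq_bigr => i _.
  rewrite -[RHS]mulrA -[X in _ = _ * X]/(g i s) /ga /e -mulrA; congr (_ * _).
  by rewrite mulrCA divff ?mulr1 // gt_eqF // gpos.
pose i0 := [arg max_(i > i1) `|ga i|]%O.
have Gmax i : `|ga i| <= `|ga i0|.
  by rewrite /i0; case: arg_maxP => // j _; apply.
set G := `|ga i0| in Gmax.
have G0 : 0 < G.
  apply: lt_le_trans (Gmax i1); rewrite normr_gt0 mulf_neq0 // gt_eqF // gpos //.
pose de := n%:R * G / C%:R.
have de0 : 0 <= de by rewrite divr_ge0 ?mulr_ge0 ?ler0n // ltW.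
have near i (s : 'I_d.+1) : i \in block r s -> `|ga i - Y s / scale r X s| <= de.
  move=> is_; have [A AP iA] := partition_mem_part i hP.
  rewrite -(geqs A s AP) (bigD1 i) //= e1 // mulr1 opprD addrA subrr sub0r normrN.
  apply: le_trans (ler_norm_sum _ _ _) _.
  apply: le_trans (_ : \sum_(j in A | j != i) G / C%:R <= _).
    apply: ler_sum => j /andP[jA ji]; rewrite normrM ler_pM //.
    have /esmall/andP[j0 j1] : j \notin block r s.
      apply/negP => js; have /eqP/cards1P[x hx] := rainb A AP s.
      have xE z : z \in A -> z \in block r s -> z == x.
        by move=> zA zs; rewrite -finset.in_set1 -hx finset.in_setI zA.
      by move: ji; rewrite (eqP (xE j jA js)) (eqP (xE i iA is_)) eqxx.
    by rewrite ger0_norm.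
  rewrite sumr_const -[X in X <= _]mulr_natl /de -mulrA ler_pM2r ?divr_gt0 //.
  by rewrite ler_nat -[X in (_ <= X)%N](card_ord n) max_card.
have close i j (s : 'I_d.+1) : i \in block r s -> j \in block r s ->
    `|ga i - ga j| <= 2 * de.
  move=> /near hi /near hj; rewrite mulr_natl mulr2n.
  apply: le_trans (lerD hi hj); rewrite (distrC (ga j)).
  by apply: le_trans (ler_normD _ _); rewrite addrA subrK.
(* Walk from the first point through the points shared by consecutive blocks. *)
pose o := Ordinal n0.
have chain k (kd : (k < d.+1)%N) i : i \in block r (Ordinal kd) ->
    `|ga i - ga o| <= k.+1%:R * (2 * de).
  elim: k kd i => [|k IH] kd i ib.
    by rewrite mul1r; apply: close ib _; rewrite inE.
  have jn : (k.+1 * (r - 1) < n)%N by rewrite /tverberg_number; nia.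
  have jk : Ordinal jn \in block r (Ordinal (ltnW kd)).
    by rewrite inE /= leqnn leq_mul2r leqnSn orbT.
  have jk1 : Ordinal jn \in block r (Ordinal kd).
    by rewrite inE /= leqnn leq_mul2r leqnSn orbT.
  rewrite -[k.+2%:R]natr1 mulrDl mul1r [leRHS]addrC.
  apply: le_trans (lerD (close _ _ _ ib jk1) (IH _ _ jk)).
  by apply: le_trans (ler_normD _ _); rewrite addrA subrK.
have far i : `|ga i - ga o| <= d.+1%:R * (2 * de).
  have [s is_] := block_cover hr i; case: s is_ => s sd /chain /le_trans; apply.
  apply: ler_wpM2r; first by rewrite mulr_ge0.
  by rewrite ler_nat.
have small i : `|ga i - ga i0| < G.
  apply: le_lt_trans (_ : 4 * d.+1%:R * de < _).
    apply: le_trans (_ : `|ga i - ga o| + `|ga i0 - ga o| <= _).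
      rewrite (distrC (ga i0)); apply: le_trans (ler_normD _ _).
      by rewrite addrA subrK.
    by have := far i; have := far i0; lra.
  rewrite /de !mulrA ltr_pdivrMr // mulrC ltr_pM2l //.
  by rewrite -!natrM ltr_nat.
exists i0 => i.
have : 0 < ga i * ga i0.
  move: (small i); rewrite /G; case: (ltrgt0P (ga i0)) => [h|h|h].
  - by rewrite ltr_norml => /andP[? _]; rewrite mulr_gt0 //; lra.
  - by rewrite ltr_norml => /andP[_ ?]; rewrite nmulr_lgt0 //; lra.
  - by move: G0; rewrite /G h normr0 ltxx.
rewrite /ga mulrACA pmulr_lgt0 // mulr_gt0 // gpos //.
Qed.
End SameSign.

(** * Convex hulls and general position *)

Section Hull.
Variables (R : realType) (d n : nat) (p : 'I_n -> 'rV[R]_d).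

Lemma convex_combination_mem (S : set 'rV[R]_d) (a : 'I_n -> R) (s : seq 'I_n) :
  convex_set (S : set (convex_lmodType 'rV[R]_d)) ->
  (forall i, 0 <= a i) -> (forall i, i \in s -> S (p i)) ->
  0 < \sum_(i <- s) a i ->
  S ((\sum_(i <- s) a i)^-1 *: \sum_(i <- s) a i *: p i).
Proof.
move=> cS a0; elim: s => [|j s IH] pS; first by rewrite big_nil ltxx.
rewrite !big_cons; set A := \sum_(i <- s) a i; set B := \sum_(i <- s) _ => jA0.
have : 0 <= A by apply: sumr_ge0.
rewrite le_eqVlt => /predU1P[A0|A0].
  have B0 : B = 0.
    rewrite /B big_seq big1 // => i is_; apply/eqP; rewrite scaler_eq0.
    move/eqP: (esym A0); rewrite psumr_eq0 => [/allP/(_ i is_) /= ->|//] //.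
  rewrite -A0 B0 !addr0 scalerA mulVf ?scale1r; first by apply: pS; rewrite mem_head.
  by move: jA0; rewrite -A0 addr0 => /gt_eqF ->.
have restS : S (A^-1 *: B) by apply: IH => // i is_; apply: pS; rewrite inE is_ orbT.
have t0 : 0 <= a j / (a j + A) by rewrite divr_ge0 // ltW.
have t1 : a j / (a j + A) <= 1 by rewrite ler_pdivrMr // mul1r lerDl ltW.
have := @cS (p j) (A^-1 *: B) (Itv01 t0 t1); rewrite !inE => /(_ _ restS).
have -> : (a j + A)^-1 *: (a j *: p j + B) = conv (Itv01 t0 t1)
    (p j : convex_lmodType 'rV[R]_d) (A^-1 *: B : convex_lmodType 'rV[R]_d).
  transitivity ((a j / (a j + A)) *: p j + (1 - a j / (a j + A)) *: (A^-1 *: B)) => //.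
  rewrite scalerDr !scalerA mulrC; congr (_ + _ *: _).
  by field; rewrite !gt_eqF.
by apply; apply: pS; rewrite mem_head.
Qed.


Lemma conv_hullP (A : {set 'I_n}) (z : 'rV[R]_d) :
  conv_hull [set p i | i in [set` A]]%classic z <->
  exists a : 'I_n -> R, [/\ forall i, 0 <= a i, \sum_(i in A) a i = 1 &
    \sum_(i in A) a i *: p i = z].
Proof.
split.
  apply: (@smallest_sub _ _ _ [set z | exists a : 'I_n -> R,
    [/\ forall i, 0 <= a i, \sum_(i in A) a i = 1 &
    \sum_(i in A) a i *: p i = z]]%classic).
    move=> x y t; rewrite !inE => -[a [a0 a1 <-]] [b [b0 b1 <-]].
    have t0 : 0 <= t%:num by [].
    have t1 : 0 <= 1 - t%:num by rewrite subr_ge0.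
    exists (fun i => t%:num * a i + (1 - t%:num) * b i); split.
    - by move=> i; rewrite addr_ge0 // mulr_ge0.
    - by rewrite big_split /= -!mulr_sumr a1 b1 !mulr1 addrC subrK.
    - rewrite [RHS]/conv /= !scaler_sumr -big_split; apply: eq_bigr => i _.
      by rewrite !scalerA scalerDl.
  move=> _ [i iA <-]; exists (fun j => (j == i)%:R); split.
  - by move=> j; rewrite ler0n.
  - by rewrite (bigD1 i) //= eqxx big1 ?addr0 // => j /andP[_ /negbTE ->].
  - by rewrite (bigD1 i) //= eqxx scale1r big1 ?addr0 // => j /andP[_ /negbTE ->]; rewrite scale0r.
case=> a [a0 a1 <-] S [cS pS].
have := @convex_combination_mem S a (enum A) cS a0.
by rewrite !big_enum /= a1 invr1 scale1r; apply=> // i; rewrite mem_enum => iA; apply: pS; exists i.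
Qed.
End Hull.

Definition lift_pt (R : realType) (d : nat) (p : 'rV[R]_d) : 'rV[R]_(d + 1) :=
  row_mx p 1%:M.

Section GeneralPosition.
Variables (R : realType) (d : nat).

(** Translated to one of its points, an affine set is closed under scaling, and
    under addition because [u + v] is the midpoint of [2 *: u] and [2 *: v]. *)
Lemma affine_combination_mem (I : finType) (S : set 'rV[R]_d) (Q : pred I)
    (b : I -> R) (q : I -> 'rV[R]_d) :
  affine_set S -> (forall i, Q i -> S (q i)) -> \sum_(i | Q i) b i = 1 ->
  S (\sum_(i | Q i) b i *: q i).
Proof.
move=> aS qS b1.
have [i0 Qi0] : exists i, Q i.
  apply/existsP; apply: contraPT b1 => /existsPn none.
  by rewrite big1 => [/esym/eqP|i]; [rewrite oner_eq0|rewrite (negbTE (none i))].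
pose x0 := q i0; have Sx0 : S x0 by apply: qS.
pose K v := S (x0 + v).
have KZ t v : K v -> K (t *: v).
  move=> Kv; have := aS _ _ t Kv Sx0.
  by rewrite /K scalerDr addrAC -scalerDl addrC subrKC scale1r addrC.
have KD u v : K u -> K v -> K (u + v).
  move=> Ku Kv; have := aS _ _ 2^-1 (KZ 2 _ Ku) (KZ 2 _ Kv).
  rewrite /K; congr S; rewrite (_ : 1 - 2^-1 = 2^-1 :> R); last by field.
  rewrite -scalerDr addrACA !scalerDr !scalerA mulVf ?pnatr_eq0 // !scale1r.
  by congr (_ + _); rewrite -scalerDl (_ : 2^-1 + 2^-1 = 1 :> R) ?scale1r //; field.
have -> : \sum_(i | Q i) b i *: q i = x0 + \sum_(i | Q i) b i *: (q i - x0).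
  rewrite [in RHS](eq_bigr (fun i => b i *: q i - b i *: x0)); last first.
    by move=> i _; rewrite scalerBr.
  by rewrite sumrB -scaler_suml b1 scale1r addrC subrK.
apply: (big_ind K) => //; first by rewrite /K addr0.
by move=> i Qi; apply: KZ; rewrite /K addrC subrK; apply: qS.
Qed.

Lemma aff_dim_point (x : 'rV[R]_d) : aff_dim [set x]%classic = 0.
Proof.
apply: xget_unique.
  exists x, 0%VS; rewrite dimv0; split=> //; apply/seteqP; split=> y /=.
    by move=> ->; exists 0; rewrite ?addr0 //= mem0v.
  by move=> [v /=]; rewrite memv0 => /eqP -> <-; rewrite addr0.
move=> _ [x' [V [e ->]]]; suff -> : V = 0%VS by rewrite dimv0.
have e0 : x' = x.
  have : [set x' + v | v in [set` V]]%classic x' by exists 0; rewrite ?addr0 //= mem0v.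
  by rewrite -e.
apply/eqP; rewrite -subv0; apply/subvP => v vV.
have : [set x' + v | v in [set` V]]%classic (x' + v) by exists v.
rewrite -e /= e0 => /eqP; rewrite addrC -subr_eq0 addrK => /eqP ->; exact: mem0v.
Qed.

(** The set lies in the zero set of a nonzero affine function, which is not the
    whole space. *)
Lemma aff_dim_lt (S : set 'rV[R]_d) (w : 'cV[R]_(d + 1)) : w != 0 ->
  (forall y, S y -> lift_pt y *m w = 0) -> aff_dim S < d%:Z.
Proof.
have full_dim : \dim (fullv : {vspace 'rV[R]_d}) = d by rewrite dimvf dim_matrix mul1r.
move=> w0 Sw; rewrite /aff_dim; case: xgetP => [k ek [x [V [e hk]]]|_]; last first.
  by apply: lt_le_trans (_ : 0 <= _).
rewrite hk ltz_nat ltn_neqAle; apply/andP; split; last first.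
  by rewrite -[X in (_ <= X)%N]full_dim dimvS ?subvf.
apply: contra w0 => /eqP dV.
have Vf : V = fullv by apply/eqP; rewrite eqEdim subvf full_dim dV leqnn.
have Sall y : lift_pt y *m w = 0.
  by apply: Sw; rewrite e; exists (y - x); rewrite ?Vf /= ?memvf // addrC subrK.
rewrite -[w]vsubmxK in Sall *; set w1 := usubmx w in Sall *; set w2 := dsubmx w in Sall *.
have w20 : w2 = 0 by have := Sall 0; rewrite /lift_pt mul_row_col mul0mx add0r mul1mx.
have w10 : w1 = 0.
  apply/row_matrixP => i; rewrite row0 rowE.
  by have := Sall (delta_mx 0 i); rewrite /lift_pt mul_row_col w20 mulmx0 addr0.
by rewrite w10 w20 col_mx0.
Qed.

(** If the lifts were dependent, one of the points, [p (c j)], would lie in the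
    affine hull [H ord0] of the others, and all of them in a hyperplane. Then the
    intersection of [H ord0] with the point has codimension [d], whereas the
    codimensions of the two add up to at least [d + 1]. *)
Lemma general_position (N : nat) (p : 'I_N -> 'rV[R]_d) (c : 'I_(d + 1) -> 'I_N) :
  (1 <= d)%N -> strong_general_position p -> injective c ->
  \det (\matrix_i lift_pt (p (c i))) != 0.
Proof.
move=> hd sgp inj; apply/negP => det0; move: (det0) => /det0P[v v0 vM].
have [w w0 hw] : exists2 w : 'cV[R]_(d + 1), w != 0 &
    forall i, lift_pt (p (c i)) *m w = 0.
  move: det0; rewrite -det_tr => /det0P[u u0 uM]; exists u^T; first by rewrite trmx_eq0.
  move=> i; apply: trmx_inj; rewrite trmx_mul trmxK trmx0.
  rewrite -(rowK (fun i => lift_pt (p (c i))) i) tr_row colE mulmxA uM.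
  exact: mul0mx.
have [j vj] : exists j, v 0 j != 0.
  apply/existsP; apply: contraNT v0 => /existsPn z.
  by apply/eqP/rowP => j; rewrite mxE; apply/eqP/negPn.
pose b i := - (v 0 j)^-1 * v 0 i.
have [b1 bp] : \sum_(i | i != j) b i = 1 /\ \sum_(i | i != j) b i *: p (c i) = p (c j).
  move: vM; rewrite mulmx_sum_row => vM.
  have vE : lift_pt (p (c j)) = \sum_(i | i != j) b i *: lift_pt (p (c i)).
    move: vM; rewrite (bigD1 j) //= rowK => /eqP; rewrite addr_eq0 => /eqP E.
    rewrite -[LHS]scale1r -(mulVf vj) -scalerA E scalerN -scaleNr scaler_sumr.
    by apply: eq_bigr => i _; rewrite rowK scalerA.
  split.
    have last_coord x : rsubmx (lift_pt x : 'rV[R]_(d + 1)) 0 0 = 1.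
      by rewrite row_mxKr mxE eqxx.
    rewrite -(last_coord (p (c j))) vE linear_sum summxE; apply: eq_bigr => i _.
    by rewrite linearZ /= mxE last_coord mulr1.
  have first_coords x : lsubmx (lift_pt x : 'rV[R]_(d + 1)) = x by rewrite row_mxKl.
  rewrite -[RHS]first_coords vE linear_sum; apply: eq_bigr => i _.
  by rewrite linearZ /= first_coords.
pose C0 := c @: [set~ j]; pose C (m : 'I_2) := if m == ord0 then C0 else [set c j]%SET.
have dis (m m' : 'I_2) : m != m' -> [disjoint C m & C m']%B.
  have d0 : [disjoint C0 & [set c j]%SET]%B.
    rewrite disjoint_sym disjoints1; apply/negP => /imsetP[i ij /inj e].
    by move: ij; rewrite e !inE eqxx.
  have [m0|m0] := eqVneq m ord0; have [m0'|m0'] := eqVneq m' ord0 => ne.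
  - by rewrite m0 m0' eqxx in ne.
  - by rewrite /C m0 eqxx (negbTE m0').
  - by rewrite /C m0' eqxx (negbTE m0) disjoint_sym.
  - by case/eqP: ne; apply: val_inj; case: m m0 => [[|[|]]] //; case: m' m0' => [[|[|]]].
have /= := sgp 2 C isT dis.
set H := fun m : 'I_2 => aff_hull _.
have H1 : H (lift ord0 ord0) = [set p (c j)]%classic.
  have C1 : C (lift ord0 ord0) = [set c j]%SET by [].
  rewrite /H C1; apply/seteqP; split.
    apply: smallest_sub; last first.
      by move=> _ [i ic <-]; move: (ic : i \in [set c j]%SET); rewrite inE => /eqP ->.
    by move=> x y t -> ->; rewrite -scalerDl addrC subrK scale1r.
  by move=> _ -> S [_]; apply; exists (c j); rewrite //= inE.
have pH0 : H ord0 (p (c j)).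
  move=> S [aS pS]; rewrite -bp; apply: affine_combination_mem => // i ij.
  by apply: pS; exists (c i) => //=; rewrite /C eqxx; apply: imset_f; rewrite !inE.
have dimH0 : aff_dim (H ord0) < d%:Z.
  apply: (aff_dim_lt w0); apply: smallest_sub.
    move=> x y t /= hx hy.
    suff -> : lift_pt (t *: x + (1 - t) *: y) = t *: lift_pt x + (1 - t) *: lift_pt y.
      by rewrite mulmxDl -!scalemxAl hx hy !scaler0 addr0.
    by rewrite /lift_pt !scale_row_mx add_row_mx -scalerDl [t + _]addrC subrK scale1r.
  by move=> _ [i + <-] /=; rewrite /C eqxx => /imsetP[i' _ ->]; apply: hw.
have -> : (\bigcap_(m in [set: 'I_2]) H m = [set p (c j)])%classic.
  apply/seteqP; split=> [x /(_ (lift ord0 ord0) I)|_ -> m _]; first by rewrite H1.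
  have [->//|m0] := eqVneq m ord0.
  by rewrite (_ : m = lift ord0 ord0) ?H1 //; apply: val_inj; case: m m0 => [[|[|]]].
rewrite aff_dim_point !big_ord_recl big_ord0.
rewrite -/(H ord0) -/(H (lift ord0 ord0)) H1 aff_dim_point; lia.
Qed.
End GeneralPosition.

(** * Existence of weights and the theorem *)

Lemma nontrivial_kernel (F : fieldType) (m k : nat) (M : 'M[F]_(m, k)) :
  (k < m)%N -> exists2 u : 'rV_m, u != 0 & u *m M = 0.
Proof.
move=> km; have : kermx M != 0.
  by rewrite -mxrank_eq0 mxrank_ker -lt0n subn_gt0 (leq_ltn_trans (rank_leq_col _)).
by case/rowV0Pn => u /sub_kermxP uM u0; exists u.
Qed.

(** The unknowns are the [n] weights and the [D] coordinates of the common sum;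
    each part imposes [D] homogeneous linear equations. *)
Lemma common_combination (F : fieldType) (n D : nat) (v : 'I_n -> 'rV[F]_D)
    (P : {set {set 'I_n}}) :
  (#|P| * D < n + D)%N -> (0 < #|P|)%N ->
  exists al : 'I_n -> F, (exists i, al i != 0) /\
    exists Z : 'rV[F]_D, forall A, A \in P -> \sum_(i in A) al i *: v i = Z.
Proof.
move=> lt P0.
pose B (m : 'I_#|P|) : 'M[F]_(n + D, D) :=
  col_mx (\matrix_i ((i \in (enum_val m : {set 'I_n}))%:R *: v i)) (- 1%:M).
have [|u u0 uB] := @nontrivial_kernel F (n + D) _ (\mxrow_m B m).
  by rewrite sum_nat_const card_ord.
have sumE A : A \in P -> \sum_(i in A) (lsubmx u) 0 i *: v i = rsubmx u.
  move=> AP; have : u *m B (enum_rank_in AP A) = 0.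
    have := congr1 (fun M => submxrow M (enum_rank_in AP A)) uB.
    by rewrite mul_mxrow mxrowK submxrow0.
  rewrite -[u in u *m _]hsubmxK mul_row_col mulmxN mulmx1 => /eqP; rewrite subr_eq0 => /eqP <-.
  rewrite mulmx_sum_row big_mkcond; apply: eq_bigr => i _.
  by rewrite rowK enum_rankK_in //; case: ifP; rewrite ?scale1r ?scale0r ?scaler0.
exists ((lsubmx u) 0); split; last by exists (rsubmx u).
apply/existsP; apply: contraNT u0 => /existsPn al0.
have l0 : lsubmx u = 0 by apply/rowP => i; rewrite [RHS]mxE; apply/eqP/negPn/al0.
have [A AP] : exists A, A \in P by apply/set0Pn; rewrite -card_gt0.
rewrite -[u]hsubmxK l0 -(sumE A AP) big1 ?row_mx0 // => i _.
by rewrite l0 mxE scale0r.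
Qed.

Section TverbergIff.
Variables (R : realType) (d r C : nat).
Hypotheses (hr : (2 <= r)%N).
Notation n := (tverberg_number r d).
Variables (q : 'I_n -> 'rV[R]_d) (f : nat -> 'cV[R]_(d + 1)) (X : nat -> nat -> R).
Hypothesis XE : forall (i : 'I_n) k, X i k = (lift_pt (q i) *m f k) 0 0.
Hypothesis hX : stretched d.+1 n C X.
Variable P : {set {set 'I_n}}.
Hypotheses (hP : finset.partition P [set: 'I_n]) (cP : #|P| = r).

Let eval_sum (A : {set 'I_n}) (a : 'I_n -> R) k :
  \sum_(i in A) a i * X i k = ((\sum_(i in A) a i *: lift_pt (q i)) *m f k) 0 0.
Proof.
rewrite mulmx_suml summxE; apply: eq_bigr => i _.
by rewrite -scalemxAl [RHS]mxE XE.
Qed.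

Let lift_sum (A : {set 'I_n}) (a : 'I_n -> R) :
  \sum_(i in A) a i *: lift_pt (q i) =
  row_mx (\sum_(i in A) a i *: q i) (\sum_(i in A) a i)%:M.
Proof.
rewrite -[LHS]hsubmxK; congr row_mx; rewrite linear_sum.
  by apply: eq_bigr => i _; rewrite linearZ /= row_mxKl.
rewrite raddf_sum; apply: eq_bigr => i _.
by rewrite linearZ /= row_mxKr scalemx1.
Qed.

Lemma tverberg_rainbow : (n * n < C)%N -> is_tverberg q P -> rainbow P.
Proof.
move=> hC [z hz].
have /choice[a ha] : forall A, exists a : 'I_n -> R, A \in P ->
    [/\ forall i, 0 <= a i, \sum_(i in A) a i = 1 & \sum_(i in A) a i *: q i = z].
  move=> A; case: (boolP (A \in P)) => [AP|_]; last by exists (fun=> 0).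
  by have /conv_hullP[a ?] := hz A AP; exists a.
pose al i := a (finset.pblock P i) i.
have [_ tP _] := and3P hP.
have alE A i : A \in P -> i \in A -> al i = a A i.
  by move=> AP iA; rewrite /al (finset.def_pblock tP AP iA).
have eqs A : A \in P -> forall k, (k <= d)%N ->
    \sum_(i in A) al i * X i k = (lift_pt z *m f k) 0 0.
  move=> AP k _; have [_ a1 az] := ha A AP.
  rewrite eval_sum (eq_bigr (fun i => a A i *: lift_pt (q i))); last first.
    by move=> i iA; rewrite (alE A).
  by rewrite lift_sum a1 az.
have al0 i : 0 <= al i.
  have [A AP iA] := partition_mem_part i hP.
  by rewrite (alE A) //; have [] := ha A AP.
apply: (rainbow_of_solution hr hX hP eqs) => // k kd.
have [A AP] : exists A, A \in P by apply/set0Pn; rewrite -card_gt0 cP; lia.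
have Xpos (i : 'I_n) : 0 < X i k by case: hX => + _; apply.
rewrite -(eqs A AP k kd) lt0r; apply/andP; split; last first.
  by apply: sumr_ge0 => i _; rewrite mulr_ge0 // ltW.
apply/eqP => s0; have [_ a1 _] := ha A AP; move: a1.
rewrite big1 => [/esym/eqP|i iA]; first by rewrite oner_eq0.
have := psumr_eq0P _ s0 iA; rewrite (alE A) // => /(_ _)/eqP.
rewrite mulf_eq0 (gt_eqF (Xpos i)) orbF => h; apply/eqP; apply: h => j _.
by rewrite mulr_ge0 // ltW.
Qed.

(** The weights have a common sign; multiplied by one of them they are positive.
    Comparing the last coordinates of the lifts shows that their sums over the
    parts agree, so they can be normalised to convex combinations. *)
Lemma rainbow_tverberg : (4 * d.+1 * n < C)%N -> rainbow P -> is_tverberg q P.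
Proof.
move=> hC rb.
have [||al [nz [Z hZ]]] := @common_combination R n (d + 1) (fun i => lift_pt (q i)) P.
- by rewrite cP /tverberg_number; nia.
- by rewrite cP; lia.
have eqs A : A \in P -> forall k, (k <= d)%N ->
    \sum_(i in A) al i * X i k = (Z *m f k) 0 0.
  by move=> AP k _; rewrite eval_sum hZ.
have [i0 pos] := rainbow_solution_same_sign hr hX hP eqs hC rb nz.
pose be i := al i0 * al i.
have be0 i : 0 < be i by rewrite /be mulrC.
have [A0 A0P i0A] := partition_mem_part i0 hP.
pose s := \sum_(i in A0) be i.
have s0 : 0 < s.
  by rewrite /s (bigD1 i0) //= ltr_wpDr // sumr_ge0 // => i _; apply: ltW.
have same A : A \in P -> \sum_(i in A) be i = s /\
    \sum_(i in A) be i *: q i = \sum_(i in A0) be i *: q i.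
  move=> AP; have : \sum_(i in A) be i *: lift_pt (q i) = \sum_(i in A0) be i *: lift_pt (q i).
    rewrite (eq_bigr (fun i => al i0 *: (al i *: lift_pt (q i)))); last first.
      by move=> i _; rewrite scalerA.
    rewrite [RHS](eq_bigr (fun i => al i0 *: (al i *: lift_pt (q i)))); last first.
      by move=> i _; rewrite scalerA.
    by rewrite -!scaler_sumr !hZ.
  rewrite !lift_sum => /eq_row_mx[-> /(congr1 (fun M : 'M_1 => M 0 0))].
  by rewrite !mxE eqxx.
exists (s^-1 *: \sum_(i in A0) be i *: q i) => A AP.
have [sA qA] := same A AP.
apply/conv_hullP; exists (fun i => s^-1 * be i); split.
- by move=> i; rewrite ltW // mulr_gt0 ?invr_gt0.
- by rewrite -mulr_sumr sA mulVf // gt_eqF.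
- by rewrite -qA scaler_sumr; apply: eq_bigr => i _; rewrite scalerA.
Qed.
End TverbergIff.

Theorem theorem1p6 (R : realType) (d r : nat) (hd : (1 <= d)%N) (hr : (2 <= r)%N) :
  exists N : nat, forall p : 'I_N -> 'rV[R]_d,
    strong_general_position p ->
    exists f : 'I_(tverberg_number r d) -> 'I_N,
      (forall i j : 'I_(tverberg_number r d), (i < j)%N -> (f i < f j)%N) /\
      forall P : {set {set 'I_(tverberg_number r d)}},
        finset.partition P [set: 'I_(tverberg_number r d)]%SET -> #|P| = r ->
        (is_tverberg (fun i => p (f i)) P <-> rainbow P).
Proof.
set n := tverberg_number r d.
pose C := (n * n + 4 * d.+1 * n).+1.
have [N hN] := stretched_subsequence R (d + 1) n C.
exists N => p sgp.
pose x i : 'rV[R]_(d + 1) := if insub i is Some o then lift_pt (p o) else 0.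
have xE (o : 'I_N) : x o = lift_pt (p o) by rewrite /x valK.
have [|s [ss sN sn] [f hf]] := hN x.
  move=> I sI bI szI.
  have IN (i : 'I_(d + 1)) : (nth 0 I i < N)%N by apply: (all_nthP 0 bI); rewrite szI.
  rewrite /bracket; pose c i := Ordinal (IN i).
  have -> : \matrix_(i < d + 1) nth 0 [seq x i | i <- I] i = \matrix_i lift_pt (p (c i)).
    apply/row_matrixP => i; rewrite !rowK (nth_map 0) ?szI //.
    by rewrite -xE.
  apply: general_position => // i j /(congr1 val) /= /eqP.
  by rewrite nth_uniq ?szI ?(sorted_uniq ltn_trans ltnn sI) // => /eqP/val_inj.
have sNth (i : 'I_n) : (nth 0 s i < N)%N by apply: (all_nthP 0 sN); rewrite sn.
exists (fun i => Ordinal (sNth i)); split=> [i j ij|P hP cP] /=.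
  by apply: (sorted_ltn_nth ltn_trans) => //; rewrite inE sn.
rewrite [X in stretched X]addn1 in hf.
have XE (i : 'I_n) k : (x (nth 0 s i) *m f k) 0 0 =
    (lift_pt (p (Ordinal (sNth i))) *m f k) 0 0 by rewrite -xE.
have hC1 : (n * n < C)%N by rewrite /C; lia.
have hC2 : (4 * d.+1 * n < C)%N by rewrite /C; lia.
split; first exact: (tverberg_rainbow hr XE hf hP cP hC1).
exact: (rainbow_tverberg hr XE hf hP cP hC2).
Qed.
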